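(* Let $\varnothing\ne T\subset\mathbb{R}$, let $(M,d)$ be a metric space, and let $\{f_j\}_{j=1}^\infty\subset M^T$ be a pointwise precompact sequence of functions such that $$\limsup_{j\to\infty}V_\varepsilon(f_j)<\infty\quad\text{for all}\quad\varepsilon>0.$$ Then there is a subsequence $\{f_{j_k}\}$ of $\{f_j\}$ which converges pointwise on $T$ to a regulated function $f\in \mathrm{R}(c)$, where $c:T\to M$ is a constant function (that is, to a function $f\in M^T$ with $\nu_n(f,c)=o(n)$).
   Context: $M^T$ is the set of all functions $T\to M$. A sequence $\{f_j\}\subset M^T$ is pointwise precompact on $T$ if for every $t\in T$ the closure in $M$ of the set $\{f_j(t):j\in\mathbb{N}\}$ is compact. Pointwise convergence $f_j\to f$ on $T$ means $\lim_{j\to\infty}d(f_j(t),f(t))=0$ for all $t\in T$. The Jordan variation of $f\in M^T$ is $$V(f)=\sup\Bigl\{\sum_{i=1}^n d(f(t_i),f(t_{i-1})): n\in\mathbb{N},\ t_0<t_1<\dots<t_n,\ t_0,\dots,t_n\in T\Bigr\}\in[0,\infty]$$ ($V(f)=0$ if $T$ is a single point), and $\mathrm{BV}(T;M)=\{f\in M^T:V(f)<\infty\}$. Let $d_\infty(f,g)=\sup_{t\in T}d(f(t),g(t))\in[0,\infty]$. The $\varepsilon$-variation of $f\in M^T$, for $\varepsilon>0$, is $$V_\varepsilon(f)=\inf\{V(g):g\in\mathrm{BV}(T;M)\text{ and }d_\infty(f,g)\le\varepsilon\}\quad(\inf\varnothing=\infty).$$ For $n\in\mathbb{N}=\{1,2,\dots\}$,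 $\{I_i\}_1^n\prec T$ denotes a collection of $n$ two-point subsets $I_i=\{s_i,t_i\}$ of $T$ with $s_1<t_1\le s_2<t_2\le\dots\le s_n<t_n$. For $f\in M^T$ and a constant function $c:T\to M$, $$\nu_n(f,c)=\sup\Bigl\{\sum_{i=1}^n d(f(s_i),f(t_i)):\{I_i\}_1^n\prec T,\ I_i=\{s_i,t_i\}\Bigr\}\in[0,\infty],$$ which is independent of the choice of $c$. If $T$ is finite with $\#(T)\ge2$, this formula is used for $n\le\#(T)-1$, and $\nu_n(f,c)=\nu_{\#(T)-1}(f,c)$ for $n>\#(T)-1$; if $T$ has one element, $\nu_n(f,c)=0$. The class $\mathrm{R}(c)$ is $\{f\in M^T:\nu_n(f,c)=o(n)\}$, where $\nu_n=o(n)$ means that all $\nu_n$ are finite and $\lim_{n\to\infty}\nu_n/n=0$; elements of $\mathrm{R}(c)$ are called regulated functions on $T$. *)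

(* Defs.v *)
(* MathComp-Analysis *)
From mathcomp Require Import all_boot all_order all_algebra finmap.
From mathcomp Require Import all_classical all_reals all_analysis.

Set Implicit Arguments.
Unset Strict Implicit.
Unset Printing Implicit Defensive.

Import Order.TTheory GRing.Theory Num.Theory.
Import numFieldNormedType.Exports.

Local Open Scope classical_set_scope.
Local Open Scope ring_scope.

(* For [T : set R], a function in M^T has type [T -> M]: the coercion
   [set_type] turns [T] into the type of its elements. *)

Section variation.
Context {R : realType} {M : metricType R} {T : set R}.
Implicit Types (f g : T -> M) (n : nat).

Definition jordan_variation_sum f n (t : nat -> T) : R :=
  \sum_(i < n) mdist (f (t i.+1)) (f (t i)).

(* [n = 0] is allowed: its empty sum 0 changes nothing when [T] has two points
   and gives V(f) = 0 when [T] is a single point. *)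
Definition jordan_variation f : \bar R :=
  ereal_sup [set x | exists n (t : nat -> T),
    (forall i, (i < n)%N -> val (t i) < val (t i.+1)) /\
    x = (jordan_variation_sum f n t)%:E].

Definition BV : set (T -> M) := [set g | (jordan_variation g < +oo)%E].

Definition dist_sup f g : \bar R :=
  ereal_sup (range (fun t : T => (mdist (f t) (g t))%:E)).

Definition eps_variation (eps : R) f : \bar R :=
  ereal_inf [set jordan_variation g |
    g in [set g | BV g /\ (dist_sup f g <= eps%:E)%E]].

(* s_0 < t_0 <= s_1 < t_1 <= ... <= s_(n-1) < t_(n-1); the values of [s] and
   [t] from index [n] on are irrelevant. *)
Definition ordered_pairs n (s t : nat -> T) : Prop :=
  (forall i, (i < n)%N -> val (s i) < val (t i)) /\
  (forall i, (i.+1 < n)%N -> val (t i) <= val (s i.+1)).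

Definition pair_oscillation f n : \bar R :=
  ereal_sup [set x | exists s t : nat -> T, ordered_pairs n s t /\
    x = (\sum_(i < n) mdist (f (s i)) (f (t i)))%:E].

(* nu_n(f, c) for a constant function c, on which it does not depend.  If [T]
   is finite, families of more than #(T) - 1 pairs do not exist and nu is
   constant from n = #(T) - 1 on; for #(T) = 1 this leaves only the empty sum,
   so nu = 0. *)
Definition modulus_of_variation f n : \bar R :=
  pair_oscillation f
    (if pselect (finite_set T) then minn n (#|` fset_set T|).-1 else n).

(* The class R(c): nu_n(f, c) = o(n). *)
Definition regulated f : Prop :=
  (forall n, modulus_of_variation f n \is a fin_num) /\
  (fun n : nat => fine (modulus_of_variation f n) / n%:R) @ \oo --> (0 : R).

Definition seq_pointwise_precompact (f : nat -> T -> M) : Prop :=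
  forall t : T, compact (closure (range (fun j => f j t))).

Definition pointwise_cvg (f : nat -> T -> M) g : Prop :=
  forall t : T, (fun j => mdist (f j t) (g t)) @ \oo --> (0 : R).

End variation.

(* Main.v *)
Require Import Defs.
From mathcomp Require Import finmap.
From mathcomp Require Import all_boot all_order all_algebra.
From mathcomp Require Import lra.
From mathcomp Require Import all_classical all_reals all_analysis.

Set Implicit Arguments.
Unset Strict Implicit.
Unset Printing Implicit Defensive.

Import Order.TTheory GRing.Theory Num.Theory.
Import numFieldNormedType.Exports.

Local Open Scope classical_set_scope.
Local Open Scope ring_scope.

(** Why the theorem is true. The bound on the [eps]-variations says that, for
    every [eps > 0], all late members of the sequence lie within [eps] of
    functions whose Jordan variations have a common bound [C]. Hence their sums
    of distances over [n] ordered pairs are at most [C + 2 eps n]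
    ([limsup_pair_sum_bounded]), and everything else is drawn from this
    inequality, written [pair_sum_bounded].

    It survives pointwise limits ([pair_sum_bounded_lim]) and, for all [eps] at
    once, it says that the modulus of variation is [o(n)]
    ([pair_sum_bounded_regulated]). So any pointwise limit is regulated, and only
    the extraction of a convergent subsequence is at stake.

    For this, count the disjoint jumps larger than a threshold [e] that a member
    of the sequence makes up to a point [x] of [T]. By the inequality this count
    is bounded, uniformly for all late members, and it is nondecreasing in [x].
    Its superlevel sets [many_jumps] are upward closed subsets of [T], and upward
    closed subsets of a chain are totally ordered by inclusion; hence a sequence
    of them has a monotone subsequence, whose membership at each point is
    eventually constant ([chain_settling_subsequence]). This replaces the Helly
    selection theorem for monotone functions. A diagonal argument makes the
    counts settle for all thresholds [2 / (k + 1)] and all levels simultaneously.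

    For a fixed threshold, the settled counts sort [T] into finitely many
    classes, and two points of one class are separated by no jump above the
    threshold of any late member ([mdist_le_same_jumps]). Choose a point in each
    class for each threshold: these are countably many points, and by
    precompactness a second diagonal argument gives convergence at all of them.
    At an arbitrary point the sequence is then Cauchy, being close to a
    convergent sequence for every threshold, and it converges by
    precompactness. *)

(** * Subsequences *)

Lemma homo_ltn_geid {phi : nat -> nat} :
  {homo phi : m n / (m < n)%N} -> forall n, (n <= phi n)%N.
Proof.
move=> hphi; elim=> // n IH.
by apply: leq_ltn_trans IH _; exact: hphi.
Qed.

Lemma subsequence_cvg_infty (phi : nat -> nat) :
  {homo phi : m n / (m < n)%N} -> phi @ \oo --> \oo.
Proof.
move=> hphi P [N _ NP]; exists N => // n Nn.
by apply: NP; exact: leq_trans Nn (homo_ltn_geid hphi n).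
Qed.

(** Successive choices, each beyond the last, form a subsequence. *)
Lemma extract_subsequence (Q : nat -> nat -> nat -> Prop) (n0 : nat) :
  (forall k n, (n0 <= n)%N -> exists2 m, (n < m)%N & Q k n m) ->
  exists2 phi : nat -> nat, {homo phi : m n / (m < n)%N} &
    forall k, Q k (phi k) (phi k.+1).
Proof.
move=> nextQ.
have /choice[next nextP] : forall kn : nat * nat, exists m,
    (n0 <= kn.2)%N -> (kn.2 < m)%N /\ Q kn.1 kn.2 m.
  move=> [k n] /=; have [n0n|_] := boolP (n0 <= n)%N; last by exists 0%N.
  by have [m nm Qm] := nextQ k n n0n; exists m.
pose phi := fix phi k := if k is k'.+1 then next (k', phi k') else n0.
have n0phi k : (n0 <= phi k)%N.
  elim: k => [|k IH] //=; have [lt_next _] := nextP (k, phi k) IH.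
  exact: leq_trans IH (ltnW lt_next).
exists phi.
  by apply: (homo_ltn ltn_trans) => k; have [] := nextP (k, phi k) (n0phi k).
by move=> k; have [] := nextP (k, phi k) (n0phi k).
Qed.

(** Properties of subsequences are stated for the filter that the subsequence
    generates on the indices: a sequence that is, from some index on, a
    subsequence of another one generates a finer filter, so stability under
    finer filters is all that the diagonal argument requires. *)
Lemma diagonal_subsequence (I : countType) (P : I -> set_system nat -> Prop) :
  (forall i (F G : set_system nat), F `<=` G -> P i F -> P i G) ->
  (forall i (phi : nat -> nat), {homo phi : m n / (m < n)%N} ->
    exists2 psi : nat -> nat, {homo psi : m n / (m < n)%N} &
      P i ((phi \o psi) @ \oo)) ->
  exists2 phi : nat -> nat, {homo phi : m n / (m < n)%N} &
    forall i, P i (phi @ \oo).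
Proof.
move=> finerP refineP.
have /choice[next nextP] : forall x : nat * (nat -> nat),
    exists psi : nat -> nat, {homo x.2 : m n / (m < n)%N} ->
      {homo psi : m n / (m < n)%N} /\
      (forall i : I, unpickle x.1 = Some i -> P i ((x.2 \o psi) @ \oo)).
  move=> [k phi] /=.
  have [hphi|nphi] := pselect {homo phi : m n / (m < n)%N}; last by exists id.
  case kE: (unpickle k) => [i|]; last by exists id => _; split.
  have [psi hpsi Ppsi] := refineP i phi hphi.
  by exists psi => _; split => // j [<-].
pose Phi := fix Phi k := if k is k'.+1 then
  Phi k' \o next (k', Phi k') else (id : nat -> nat).
have hPhi k : {homo Phi k : m n / (m < n)%N}.
  elim: k => [|k IH] //= m n mn; have [hnext _] := nextP (k, Phi k) IH.
  by apply: IH; exact: hnext.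
have hnext k : {homo next (k, Phi k) : m n / (m < n)%N}.
  by have [] := nextP (k, Phi k) (hPhi k).
have Phi_refines i k : exists2 theta : nat -> nat,
    {homo theta : m n / (m < n)%N} & Phi (k + i)%N = Phi i \o theta.
  elim: k => [|k [theta htheta IH]]; first by exists id.
  exists (theta \o next ((k + i)%N, Phi (k + i)%N)).
    by move=> m n mn; apply: htheta; exact: hnext.
  by rewrite addSn /= {1}IH.
exists (fun n => Phi n n).
  apply: (homo_ltn ltn_trans) => n /=; apply: hPhi.
  by apply: leq_trans (homo_ltn_geid (hnext n) n.+1).
move=> i; set k := pickle i.
have [_ /(_ i (pickleK i)) Pk] := nextP (k, Phi k) (hPhi k).
apply: finerP Pk => B [N _ NB].
exists (maxn N k.+1) => // n /=; rewrite geq_max => /andP[Nn kn].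
have [theta htheta thetaE] := Phi_refines k.+1 (n - k.+1)%N.
rewrite subnK // in thetaE; rewrite /= thetaE.
by apply: NB => /=; exact: leq_trans Nn (homo_ltn_geid htheta n).
Qed.

Definition settles {X : Type} (F : set_system nat) (A : nat -> set X) :=
  forall x, (\forall j \near F, A j x) \/ (\forall j \near F, ~ A j x).

Lemma nondecreasing_settles (X : Type) (A : nat -> set X) :
  (forall k, A k `<=` A k.+1) -> settles \oo A.
Proof.
move=> AS x.
have Ale i j : (i <= j)%N -> A i `<=` A j.
  by move=> /subnK <-; elim: (j - i)%N => // d IH y /IH; exact: AS.
have [[i Aix]|nA] := pselect (exists i, A i x); [left|right].
  by exists i => // j /= ij; exact: Ale ij _ Aix.
by apply: nearW => j Ajx; apply: nA; exists j.
Qed.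

Lemma nonincreasing_settles (X : Type) (A : nat -> set X) :
  (forall k, A k.+1 `<=` A k) -> settles \oo A.
Proof.
move=> AS x.
have [|near_in|near_out] := @nondecreasing_settles X (fun k => ~` A k) _ x.
- by move=> k y nAk /AS.
- by right.
- by left; apply: filterS near_out => j; exact: contrapT.
Qed.

(** A sequence of sets any two of which are comparable for inclusion has a
    monotone subsequence, as every sequence in a total order does: either there
    are infinitely many peaks, members that contain all later ones, or from
    some index on every member is contained in a later one. *)
Lemma chain_settling_subsequence (X : Type) (A : nat -> set X) :
  (forall i j, A i `<=` A j \/ A j `<=` A i) ->
  exists2 phi : nat -> nat, {homo phi : m n / (m < n)%N} &
    settles (phi @ \oo) A.
Proof.
move=> chainA.
pose peak n := forall m, (n < m)%N -> A m `<=` A n.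
have [peaks|/existsNP[n0 no_peak]] :=
    pselect (forall n, exists2 m, (n < m)%N & peak m).
  have [|phi hphi peak_phi] :=
      @extract_subsequence (fun _ _ m => peak m) 0%N.
    by move=> _ n _; exact: peaks.
  exists (phi \o S); first by move=> m n mn; exact: hphi.
  have := @nonincreasing_settles _ (A \o (phi \o S)).
  by apply=> k; apply: peak_phi; exact: hphi.
have [|phi hphi Aphi] :=
    @extract_subsequence (fun _ n m => A n `<=` A m) n0.+1.
  move=> _ n n0n; apply: contrapT => not_below; apply: no_peak.
  exists n => // m nm; have [Anm|//] := chainA n m.
  by exfalso; apply: not_below; exists m.
exists phi => //; exact: (@nondecreasing_settles _ (A \o phi)).
Qed.

(** * Sequences in compact subsets of a metric space *)

Section compact_sequences.
Context {R : realType} {M : metricType R}.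
Import metricType_numDomainType.

Lemma compact_cluster_point (K : set M) (v : nat -> M) :
  compact K -> (forall n, K (v n)) ->
  exists p, forall e : R, 0 < e -> forall N,
    exists2 n, (N <= n)%N & mdist p (v n) < e.
Proof.
move=> cK Kv.
have [|p [_ clp]] := cK (v @ \oo) _.
  by exists 0%N => // n _; exact: Kv.
exists p => e e0 N.
have [_ [[n Nn <-] pn]] : v @` [set n | (N <= n)%N] `&` ball p e !=set0.
  apply: clp; last exact: nbhsx_ballx.
  by exists N => // n Nn; exists n.
by exists n => //; move: pn; rewrite ballEmdist.
Qed.

Lemma compact_cvg_subsequence (K : set M) (v : nat -> M) :
  compact K -> (forall n, K (v n)) ->
  exists2 psi : nat -> nat, {homo psi : m n / (m < n)%N} &
    exists p : M, v \o psi @ \oo --> p.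
Proof.
move=> cK Kv; have [p pP] := compact_cluster_point cK Kv.
have [|psi hpsi psiP] := @extract_subsequence
    (fun k _ m => mdist p (v m) < k.+1%:R^-1) 0%N.
  by move=> k n _; have [|m nm] := pP k.+1%:R^-1 _ n.+1; [|exists m].
exists (psi \o S); first by move=> m n mn; exact: hpsi.
exists p; apply/cvgrPdist_lt => e e0.
near=> k; apply: lt_trans (psiP k) _.
by near: k; exact: (near_infty_natSinv_lt (PosNum e0)).
Unshelve. all: by end_near. Qed.

Lemma compact_small_tails_cvg (K : set M) (v : nat -> M) :
  compact K -> (forall n, K (v n)) ->
  (forall e : R, 0 < e -> exists q, \forall n \near \oo, mdist q (v n) <= e) ->
  exists p : M, v @ \oo --> p.
Proof.
move=> cK Kv cauchy; have [p pP] := compact_cluster_point cK Kv.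
exists p; apply/cvgrPdist_lt => e e0.
have e4 : 0 < e / 4 by rewrite divr_gt0.
have [q [N _ Nq]] := cauchy _ e4.
have [m Nm pm] := pP _ e4 N.
exists N => // n Nn.
have qm := Nq m Nm; have qn := Nq n Nn.
have := metric_triangle p (v m) (v n); have := metric_triangle (v m) q (v n).
rewrite (metric_sym (v m) q); lra.
Qed.

End compact_sequences.

(** * Sums over ordered pairs *)

Section oscillation_bounds.
Context {R : realType} {M : metricType R} {T : set R}.
Implicit Types (h g : T -> M) (e eps C : R).

Lemma ordered_pairs_widen n (s t : nat -> T) :
  ordered_pairs n.+1 s t -> ordered_pairs n s t.
Proof.
by move=> [st ts]; split=> i lt_i; [apply: st|apply: ts]; exact: ltnW.
Qed.

(** The sum over the pairs is at most the sum along a chain through all their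
    points; this fails to be immediate only because consecutive pairs may share
    an endpoint, which a strictly increasing chain must visit once. *)
Lemma pair_sum_le_variation g n (s t : nat -> T) :
  ordered_pairs n s t ->
  ((\sum_(i < n) mdist (g (s i)) (g (t i)))%:E <= jordan_variation g)%E.
Proof.
pose reaches (x : T) (c : R) := exists m (u : nat -> T),
  [/\ forall i, (i < m)%N -> val (u i) < val (u i.+1), u m = x &
      c <= jordan_variation_sum g m u].
have reaches0 x : reaches x 0.
  by exists 0%N, (fun=> x); split => //; rewrite /jordan_variation_sum big_ord0.
have extend x y c : val x <= val y -> reaches x c ->
    reaches y (c + mdist (g x) (g y)).
  rewrite le_eqVlt => /orP[/eqP/val_inj <-|xy] [m [u [u_incr umx cu]]].
    by rewrite mdistxx addr0; exists m, u.
  exists m.+1, (fun i => if (i <= m)%N then u i else y); split.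
  - move=> i; rewrite ltnS leq_eqVlt => /orP[/eqP ->|im] /=.
      by rewrite eqxx ltnn umx.
    by rewrite im orbT; exact: u_incr.
  - by rewrite ltnn.
  - rewrite /jordan_variation_sum big_ord_recr /= leqnn ltnn umx metric_sym.
    rewrite lerD2r; apply: le_trans cu _.
    by apply: ler_sum => i _; rewrite ltn_ord (ltnW (ltn_ord i)).
have reaches_last k : ordered_pairs k.+1 s t ->
    reaches (t k) (\sum_(i < k.+1) mdist (g (s i)) (g (t i))).
  elim: k => [|k IH] st; rewrite big_ord_recr /=.
    by rewrite big_ord0; exact: extend (ltW (st.1 _ _)) (reaches0 _).
  apply: (extend (s k.+1)); first exact/ltW/st.1.
  have /IH reach_tk := ordered_pairs_widen st.
  have [m [u [u_incr um le_sum]]] := extend _ _ _ (st.2 k (ltnSn _)) reach_tk.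
  exists m, u; split => //; apply: le_trans le_sum.
  by rewrite lerDl mdist_ge0.
move=> st.
suff [x [m [u [u_incr _ le_sum]]]] :
    exists x, reaches x (\sum_(i < n) mdist (g (s i)) (g (t i))).
  apply: (@le_trans _ _ (jordan_variation_sum g m u)%:E).
    by rewrite lee_fin.
  by apply: ereal_sup_ubound; exists m, u.
case: n st => [_|n /reaches_last]; last by exists (t n).
by exists (s 0%N); rewrite big_ord0.
Qed.

Definition pair_sum_bounded h C e := forall n (s t : nat -> T),
  ordered_pairs n s t ->
  \sum_(i < n) mdist (h (s i)) (h (t i)) <= C + e * n%:R.

(** A function [g] within [eps] of [h] changes the distance over one pair by at
    most [2 eps]. *)
Lemma eps_variation_pair_sum_bounded eps C h :
  (eps_variation eps h < C%:E)%E -> pair_sum_bounded h C (eps * 2).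
Proof.
move=> /ereal_inf_lt[_ [g [_ hg] <-] VgC] n s t st.
have close x : mdist (h x) (g x) <= eps.
  rewrite -lee_fin; apply: le_trans hg.
  by apply: ereal_sup_ubound; exists x.
have gC : \sum_(i < n) mdist (g (s i)) (g (t i)) <= C.
  rewrite -lee_fin; apply: le_trans (ltW VgC).
  exact: pair_sum_le_variation.
have -> : eps * 2 * n%:R = \sum_(i < n) eps * 2.
  by rewrite sumr_const card_ord mulr_natr.
apply: le_trans (lerD gC (lexx _)).
rewrite -big_split /=; apply: ler_sum => i _.
have := metric_triangle (h (s i)) (g (s i)) (h (t i)).
have := metric_triangle (g (s i)) (g (t i)) (h (t i)).
have := close (s i); have := close (t i).
rewrite (metric_sym (g (t i))); lra.
Qed.

Lemma limsup_pair_sum_bounded (f : nat -> T -> M) :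
  (forall eps, 0 < eps ->
    (limn_esup (fun j => eps_variation eps (f j)) < +oo)%E) ->
  forall e, 0 < e -> exists C, \forall j \near \oo, pair_sum_bounded (f j) C e.
Proof.
move=> limsup_fin e e0.
have e2 : 0 < e / 2 by rewrite divr_gt0.
have [_ [B nearB <-] supB] := ereal_inf_lt (limsup_fin _ e2).
have [C supC] : exists C, (ereal_sup
    ((fun j => eps_variation (e / 2) (f j)) @` B) < C%:E)%E.
  move: supB; case: (ereal_sup _) => [r _|//|_].
    by exists (r + 1); rewrite lte_fin ltrDl.
  by exists 0; rewrite ltNyr.
exists C; apply: filterS nearB => j Bj.
rewrite -(divfK (_ : 2 != 0) e) //; apply: eps_variation_pair_sum_bounded.
by apply: le_lt_trans supC; apply: ereal_sup_ubound; exists j.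
Qed.

(** * Points preceded by many large jumps *)

(** The points at or before which [h] makes [m] disjoint jumps larger than
    [e]: these are the superlevel sets of the nondecreasing function that counts
    large jumps. *)
Definition many_jumps h e m : set T := [set x | exists s t : nat -> T,
  [/\ ordered_pairs m s t,
      forall i, (i < m)%N -> val (t i) <= val x &
      forall i, (i < m)%N -> e < mdist (h (s i)) (h (t i))]].

Lemma many_jumps_upward h e m x y :
  val x <= val y -> many_jumps h e m x -> many_jumps h e m y.
Proof.
move=> xy [s [t [st tx jump]]]; exists s, t; split => // i im.
exact: le_trans (tx i im) xy.
Qed.

(** Upward closed subsets of a chain are comparable for inclusion. *)
Lemma many_jumps_chain h h' e m :
  many_jumps h e m `<=` many_jumps h' e m \/
  many_jumps h' e m `<=` many_jumps h e m.
Proof.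
have [|/existsNP[x /not_implyP[hx nh'x]]] :=
  pselect (many_jumps h e m `<=` many_jumps h' e m); first by left.
right => y h'y; have [xy|yx] := leP (val x) (val y).
  exact: many_jumps_upward xy hx.
by exfalso; apply: nh'x; exact: many_jumps_upward (ltW yx) h'y.
Qed.

Lemma many_jumpsS h e m x y : val x < val y -> e < mdist (h x) (h y) ->
  many_jumps h e m x -> many_jumps h e m.+1 y.
Proof.
move=> xy hxy [s [t [[st ts] tx jump]]].
exists (fun i => if (i < m)%N then s i else x).
exists (fun i => if (i < m)%N then t i else y).
split; first split.
- by move=> i _; case: ifP => // /st.
- move=> i; rewrite ltnS => im; rewrite im.
  by case: ifP => [/ts //|_]; exact: tx.
- move=> i _; case: ifP => // im.
  exact: le_trans (tx i im) (ltW xy).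
- by move=> i _; case: ifP => // /jump.
Qed.

(** A jump larger than [e] between two points would raise the number of large
    jumps, which cannot happen if the counts agree up to a level [B] that is
    never attained. *)
Lemma mdist_le_same_jumps h e B x y : 0 <= e ->
  (forall z, ~ many_jumps h e B z) ->
  (forall m, (m < B)%N -> many_jumps h e m x <-> many_jumps h e m y) ->
  mdist (h x) (h y) <= e.
Proof.
move=> e0 noB; wlog : x y / val x < val y => [wlog_lt same|xy same].
  have [xy|yx|/val_inj eq_xy] := ltgtP (val x) (val y).
  - exact: wlog_lt.
  - by rewrite metric_sym; apply: wlog_lt => // m /same[].
  - by rewrite eq_xy mdistxx.
rewrite leNgt; apply/negP => hxy.
suff attained m : (m <= B)%N -> many_jumps h e m y by exact: noB (attained B _).
elim: m => [_|m IH mB]; first by exists (fun=> y), (fun=> y); split.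
by apply: many_jumpsS xy hxy _; apply/same => //; apply: IH; exact: ltnW.
Qed.

(** [B] jumps larger than [2 e] make a sum above [2 e B], while [C + e B] bounds
    it; so [B] cannot exceed [C / e]. *)
Lemma pair_sum_bounded_no_jumps h C e : 0 < e -> pair_sum_bounded h C e ->
  forall x, ~ many_jumps h (e * 2) (Num.truncn (C / e)).+1 x.
Proof.
move=> e0 hC x [s [t [st _ jump]]].
set B := (Num.truncn _).+1 in st jump.
have : C < B%:R * e by rewrite -ltr_pdivrMr //; exact: truncnS_gt.
have : \sum_(i < B) (e * 2) <= \sum_(i < B) mdist (h (s i)) (h (t i)).
  by apply: ler_sum => i _; apply/ltW/jump.
rewrite sumr_const card_ord -mulr_natr; have := hC _ _ _ st; lra.
Qed.

End oscillation_bounds.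

(** * Regulated limits *)

Section regulated_limits.
Context {R : realType} {M : metricType R} {T : set R}.
Implicit Types (h g : T -> M) (e C : R).

Lemma near_forall_lt (I : Type) (F : set_system I) (FF : Filter F)
    (P : nat -> I -> Prop) n :
  (forall m, (m < n)%N -> \forall i \near F, P m i) ->
  \forall i \near F, forall m, (m < n)%N -> P m i.
Proof.
elim: n => [_|n IH nearP]; first exact: nearW.
have : \forall i \near F, P n i by exact: nearP.
have : \forall i \near F, forall m, (m < n)%N -> P m i.
  by apply: IH => m mn; apply: nearP; exact: ltnW.
apply: filterS2 => i below_n at_n m.
by rewrite ltnS leq_eqVlt => /orP[/eqP ->|/below_n].
Qed.


Lemma pair_sum_bounded_lim (F : set_system nat) (FF : ProperFilter F)
    (f : nat -> T -> M) g C e :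
  (forall x, (fun j => f j x) @ F --> g x) ->
  (\forall j \near F, pair_sum_bounded (f j) C e) -> pair_sum_bounded g C e.
Proof.
move=> fg fC n s t st; apply/ler_addgt0Pl => d d0.
(* 2 d' per pair adds up to at most d over n pairs; n.+1 so that n = 0 is fine *)
set d' := d / (n.+1%:R * 2).
have d'0 : 0 < d' by rewrite divr_gt0 // mulr_gt0.
have close : \forall j \near F, forall i, (i < n)%N ->
    mdist (g (s i)) (f j (s i)) < d' /\ mdist (g (t i)) (f j (t i)) < d'.
  apply: near_forall_lt => i _.
  have /metricType_numDomainType.cvgrPdist_lt /(_ _ d'0) fs := fg (s i).
  have /metricType_numDomainType.cvgrPdist_lt /(_ _ d'0) ft := fg (t i).
  by apply: filterS2 fs ft.
have [j [fjC closej]] := filter_ex (filterI fC close).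
have := fjC n s t st.
have : \sum_(i < n) mdist (g (s i)) (g (t i)) <=
    \sum_(i < n) mdist (f j (s i)) (f j (t i)) + \sum_(i < n) (d' * 2).
  rewrite -big_split /=; apply: ler_sum => i _.
  have [gs gt] := closej i (ltn_ord i).
  have := metric_triangle (g (s i)) (f j (s i)) (g (t i)).
  have := metric_triangle (f j (s i)) (f j (t i)) (g (t i)).
  rewrite (metric_sym (f j (t i)) (g (t i))); lra.
rewrite sumr_const card_ord -mulr_natr.
have : d' * 2 * n%:R <= d.
  rewrite /d' invfM mulrA divfK // -mulrA ger_pMr // mulrC.
  by rewrite ler_pdivrMr // mul1r ler_nat.
lra.
Qed.

(** Consecutive elements of the sorted list are the pairs: they share endpoints,
    so [n] pairs need only [n + 1] points. *)
Lemma finite_subset_ordered_pairs n (A : seq R) : T !=set0 ->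
  uniq A -> {subset A <= T} -> (n < size A)%N ->
  exists s t : nat -> T, ordered_pairs n s t.
Proof.
move=> [t0 Tt0] uniqA AT nA.
pose a0 : T := exist _ t0 (mem_set Tt0).
pose x i : T := insubd a0 (nth 0 (sort <=%O A) i).
have valx i : (i < size A)%N -> val (x i) = nth 0 (sort <=%O A) i.
  move=> iA; rewrite insubdK //; apply: AT.
  by rewrite -(mem_sort <=%O) mem_nth // size_sort.
exists x, (x \o S); split => i ni /=; last by [].
have iA : (i.+1 < size A)%N by exact: leq_ltn_trans nA.
rewrite !valx ?(ltnW iA) // lt_sorted_ltn_nth ?inE ?size_sort ?(ltnW iA) //.
by rewrite sort_lt_sorted.
Qed.

Let nb_pairs n : nat :=
  if pselect (finite_set T) then minn n (#|` fset_set T|).-1 else n.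

Lemma exists_ordered_pairs n : T !=set0 ->
  exists s t : nat -> T, ordered_pairs (nb_pairs n) s t.
Proof.
move=> T0; rewrite /nb_pairs; case: pselect => [finT|infT].
  apply: (@finite_subset_ordered_pairs _ (fset_set T)) => //.
  - exact: fset_uniq.
  - by move=> x; rewrite in_fset_set.
  - have cardT : (0 < size (fset_set T))%N.
      rewrite cardfs_gt0; apply/fset0Pn; case: T0 => x Tx.
      by exists x; rewrite in_fset_set ?mem_set.
    by rewrite gtn_min ltn_predL cardT orbT.
have [B BT nB] := infinite_set_fset n.+1 infT.
apply: (@finite_subset_ordered_pairs _ B) => //; first exact: fset_uniq.
by move=> x xB; rewrite inE; exact: BT.
Qed.

(** The value [-oo] of an empty supremum is excluded by the existence of
    ordered pairs, so the modulus of variation lies between [0] and [C + e * n]. *)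
Lemma pair_sum_bounded_modulus h C e n : T !=set0 -> 0 <= e ->
  pair_sum_bounded h C e ->
  exists2 v : R, modulus_of_variation h n = v%:E & 0 <= v <= C + e * n%:R.
Proof.
move=> T0 e0 hC.
have nu_ge0 : (0 <= modulus_of_variation h n)%E.
  have [s [t st]] := exists_ordered_pairs n T0.
  apply: (@le_trans _ _ (\sum_(i < nb_pairs n) mdist (h (s i)) (h (t i)))%:E).
    by rewrite lee_fin sumr_ge0 // => i _; exact: mdist_ge0.
  by apply: ereal_sup_ubound; exists s, t.
have nu_le : (modulus_of_variation h n <= (C + e * n%:R)%:E)%E.
  apply: ge_ereal_sup => _ [s [t [st ->]]]; rewrite lee_fin.
  apply: le_trans (hC _ _ _ st) _.
  rewrite lerD2l ler_wpM2l // ler_nat.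
  by case: pselect => [finT|//]; exact: geq_minl.
move: nu_ge0 nu_le; case: (modulus_of_variation h n) => [v|//|//].
by rewrite !lee_fin => v0 vC; exists v; rewrite ?v0.
Qed.

Lemma pair_sum_bounded_regulated g : T !=set0 ->
  (forall e, 0 < e -> exists C, pair_sum_bounded g C e) -> regulated g.
Proof.
move=> T0 bounded; split.
  move=> n; have [C gC] := bounded 1 ltr01.
  by have [v -> _] := pair_sum_bounded_modulus n T0 ler01 gC.
apply/cvgrPdist_lt => e e0; have e2 : 0 < e / 2 by rewrite divr_gt0.
have [C gC] := bounded _ e2.
near=> n; have n0 : 0 < n%:R :> R.
  by rewrite ltr0n; near: n; exists 1%N.
have [v -> /andP[v0 vC]] := pair_sum_bounded_modulus n T0 (ltW e2) gC.
rewrite sub0r normrN ger0_norm /= ?divr_ge0 ?(ltW n0) // ltr_pdivrMr //.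
suff : C < e / 2 * n%:R by lra.
rewrite -ltr_pdivrMl //; apply: lt_le_trans (truncnS_gt _) _.
rewrite ler_nat; near: n; exact: nbhs_infty_ge.
Unshelve. all: by end_near. Qed.

End regulated_limits.

(** * The selection principle *)

Section selection.
Context {R : realType} {M : metricType R} {T : set R}.
Implicit Type (f : nat -> T -> M).

(** At each level [k] the points of [T] are sorted into finitely many classes by
    the jump counts to which the sequence settles. Within one class the members
    of the sequence eventually vary by at most [e k], so convergence at one
    representative of each class, countably many points in all, controls the
    sequence everywhere. *)
Lemma settled_jumps_representatives f (F : set_system nat) (FF : Filter F)
    (e : nat -> R) (B : nat -> nat) : T !=set0 -> (forall k, 0 <= e k) ->
  (forall k, \forall j \near F, forall x, ~ many_jumps (f j) (e k) (B k) x) ->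
  (forall k m, settles F (fun j => many_jumps (f j) (e k) m)) ->
  exists rep : nat * seq bool -> T, forall x k, exists v,
    \forall j \near F, mdist (f j (rep (k, v))) (f j x) <= e k.
Proof.
move=> [t0 Tt0] e0 no_jumps settled.
pose a0 : T := exist _ t0 (mem_set Tt0).
pose sig k x := mkseq
  (fun m => `[< \forall j \near F, many_jumps (f j) (e k) m x >]) (B k).
have /choice[rep repP] : forall kv : nat * seq bool, exists x,
    (exists y, sig kv.1 y = kv.2) -> sig kv.1 x = kv.2.
  move=> kv; have [[x xP]|no] := pselect (exists x, sig kv.1 x = kv.2).
    by exists x.
  by exists a0 => /no.
exists rep => x k; exists (sig k x).
have := repP (k, sig k x) (ex_intro _ x erefl) => /=.
set y := rep _ => sig_xy.
have same : \forall j \near F, forall m, (m < B k)%N ->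
    many_jumps (f j) (e k) m y <-> many_jumps (f j) (e k) m x.
  apply: near_forall_lt => m mB.
  have /(congr1 (nth false ^~ m)) := sig_xy; rewrite !nth_mkseq //.
  move=> eq_yx; have [yx xy] := asbool_eq_equiv eq_yx.
  have [yin|yout] := settled k m y.
    by apply: filterS2 yin (yx yin) => j.
  have [xin|xout] := settled k m x.
    by apply: filterS2 (xy xin) xin => j.
  by apply: filterS2 yout xout => j.
apply: filterS2 same (no_jumps k) => j samej nojumpj.
exact: mdist_le_same_jumps (e0 k) nojumpj samej.
Qed.

End selection.

Theorem theorem3 (R : realType) (T : set R) (T0 : T !=set0) (M : metricType R)
    (f : nat -> T -> M) (fprecompact : seq_pointwise_precompact f)
    (flimsup : forall eps : R, 0 < eps ->
      (limn_esup (fun j => eps_variation eps (f j)) < +oo)%E) :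
  exists (phi : nat -> nat) (g : T -> M),
    [/\ {homo phi : m n / (m < n)%N},
        pointwise_cvg (fun k => f (phi k)) g &
        regulated g].
Proof.
have bounded := limsup_pair_sum_bounded flimsup.
(* jumps above twice the slope 1 / k.+1 of the linear bound are rare *)
pose e k : R := k.+1%:R^-1 * 2.
have e0 k : 0 <= e k by rewrite mulr_ge0.
have /choice[B no_jumps] : forall k, exists B,
    \forall j \near \oo, forall x, ~ many_jumps (f j) (e k) B x.
  move=> k; have k0 : 0 < k.+1%:R^-1 :> R by rewrite invr_gt0.
  have [C fC] := bounded _ k0.
  exists (Num.truncn (C / k.+1%:R^-1)).+1.
  by apply: filterS fC => j; exact: pair_sum_bounded_no_jumps.
have [||phi hphi settled] := @diagonal_subsequence (nat * nat)%type
    (fun km F => settles F (fun j => many_jumps (f j) (e km.1) km.2)).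
- move=> [k m] F G FG sF x.
  by have [/FG|/FG] := sF x; [left|right].
- move=> [k m] phi hphi.
  have [|psi hpsi] := @chain_settling_subsequence T
      (fun j => many_jumps (f (phi j)) (e k) m).
    by move=> i j; exact: many_jumps_chain.
  by exists psi.
have [rep repP] := settled_jumps_representatives _ T0 e0
  (fun k => subsequence_cvg_infty hphi (no_jumps k))
  (fun k m => settled (k, m)).
have in_closure t j : closure (range (fun i => f i t)) (f j t).
  by apply: subset_closure; exists j.
have [||psi hpsi cvg_rep] := @diagonal_subsequence (nat * seq bool)%type
    (fun kv F => exists p : M, (fun j => f (phi j) (rep kv)) @ F --> p).
- move=> kv F G FG [p Fp]; exists p; apply: cvg_trans Fp.
  by move=> P; exact: FG.
- move=> kv psi hpsi.
  exact: (compact_cvg_subsequence (fprecompact (rep kv))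
            (fun n => in_closure (rep kv) (phi (psi n)))).
have cvg_everywhere t : exists p : M, (fun j => f (phi (psi j)) t) @ \oo --> p.
  apply: (@compact_small_tails_cvg _ _ _ (fun j => f (phi (psi j)) t)
    (fprecompact t)) => // d d0.
  (* d / 4 at the representative plus e k < d / 2 within the class *)
  have [k kd] : exists k, k.+1%:R^-1 < d / 4.
    have d4 : 0 < d / 4 by rewrite divr_gt0.
    by have [k] := filter_ex (near_infty_natSinv_lt (PosNum d4)); exists k.
  have [v close] := repP t k.
  have [p /metricType_numDomainType.cvgrPdist_lt cvg_p] := cvg_rep (k, v).
  exists p.
  have p_near : \forall j \near \oo,
      mdist p (f (phi (psi j)) (rep (k, v))) < d / 4.
    by apply: cvg_p; exact: divr_gt0.
  have close_near : \forall j \near \oo,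
      mdist (f (phi (psi j)) (rep (k, v))) (f (phi (psi j)) t) <= e k.
    exact: (@subsequence_cvg_infty psi hpsi _ close).
  apply: filterS2 p_near close_near => j; rewrite /e => p_j close_j.
  have := metric_triangle p (f (phi (psi j)) (rep (k, v))) (f (phi (psi j)) t).
  move: close_j kd; set u := _^-1; lra.
have [g gP] := choice cvg_everywhere.
have hphipsi : {homo phi \o psi : m n / (m < n)%N}.
  by move=> m n mn; apply: hphi; exact: hpsi.
exists (phi \o psi), g; split => //.
- move=> t; apply/cvgrPdist_lt => d d0.
  have /metricType_numDomainType.cvgrPdist_lt /(_ _ d0) := gP t.
  apply: filterS => j; rewrite sub0r normrN ger0_norm ?mdist_ge0 //.
  by rewrite metric_sym.
- apply: pair_sum_bounded_regulated => // d d0.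
  have [C fC] := bounded d d0; exists C.
  apply: (@pair_sum_bounded_lim _ _ _ ((phi \o psi) @ \oo) _ f) => //.
  exact: (@subsequence_cvg_infty _ hphipsi _ fC).
Qed.
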